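(* Let $\mathcal K$ be a bicategory, and let $(A,B,p,q,\mu,\tau)$ and $(A,B,p,q',\mu',\tau')$ be two firm Morita contexts in $\mathcal K$ with the same objects $A,B$ and the same 1-cell $p\colon A\to B$. Then there is an isomorphism $q\cong q'$ that makes these two Morita contexts isomorphic.
   Context: Juxtaposition is composition of 1-cells, $*$ is horizontal composition of 2-cells, $\circ$ is vertical composition of 2-cells; the associativity and unit constraints of the bicategory are suppressed. A (wide) Morita context $(A,B,p,q,\mu,\tau)$ in a bicategory $\mathcal K$ consists of objects $A,B$, 1-cells $p\colon A\to B$ and $q\colon B\to A$, and 2-cells $\mu\colon qp\Rightarrow1_A$, $\tau\colon pq\Rightarrow1_B$ such that $1_p*\mu=\tau*1_p\colon pqp\Rightarrow p$ and $1_q*\tau=\mu*1_q\colon qpq\Rightarrow q$. It is called firm if the 2-cells $1_p*\mu=\tau*1_p$ and $1_q*\tau=\mu*1_q$ are invertible (whereas $\mu,\tau$ themselves need not be). An isomorphism $q\cong q'$ (invertible 2-cell $\phi\colon q\Rightarrow q'$) makes the contexts $(A,B,p,q,\mu,\tau)$ and $(A,B,p,q',\mu',\tau')$ isomorphic if $\mu'\circ(\phi*1_p)=\mu$ and $\tau'\circ(1_p*\phi)=\tau$. *)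

(* Defs.v *)
Set Implicit Arguments.
Unset Strict Implicit.
Unset Printing Implicit Defensive.

Declare Scope bicat_scope.
Delimit Scope bicat_scope with bicat.
Local Open Scope bicat_scope.

(* Compositions are written in the applicative order: [comp1 g f] is the
   1-cell "gf" obtained by doing f first, [vcomp b a] does a first, and
   [hcomp b a] is b * a with a between the 1-cells on the right. *)
Record bicat_data := BicatData {
  ob : Type;
  cell1 : ob -> ob -> Type;
  cell2 : forall A B : ob, cell1 A B -> cell1 A B -> Type;

  id1 : forall A : ob, cell1 A A;
  comp1 : forall A B C : ob, cell1 B C -> cell1 A B -> cell1 A C;

  id2 : forall (A B : ob) (f : cell1 A B), cell2 f f;
  vcomp : forall (A B : ob) (f g h : cell1 A B),
    cell2 g h -> cell2 f g -> cell2 f h;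
  hcomp : forall (A B C : ob) (g g' : cell1 B C) (f f' : cell1 A B),
    cell2 g g' -> cell2 f f' -> cell2 (comp1 g f) (comp1 g' f');

  assoc : forall (A B C D : ob)
      (h : cell1 C D) (g : cell1 B C) (f : cell1 A B),
    cell2 (comp1 (comp1 h g) f) (comp1 h (comp1 g f));
  assoc_inv : forall (A B C D : ob)
      (h : cell1 C D) (g : cell1 B C) (f : cell1 A B),
    cell2 (comp1 h (comp1 g f)) (comp1 (comp1 h g) f);
  lunit : forall (A B : ob) (f : cell1 A B), cell2 (comp1 (id1 B) f) f;
  lunit_inv : forall (A B : ob) (f : cell1 A B), cell2 f (comp1 (id1 B) f);
  runit : forall (A B : ob) (f : cell1 A B), cell2 (comp1 f (id1 A)) f;
  runit_inv : forall (A B : ob) (f : cell1 A B), cell2 f (comp1 f (id1 A))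
}.

Arguments cell1 {_} _ _.
Arguments cell2 {_ _ _} _ _.
Arguments id1 {_} _.
Arguments comp1 {_ _ _ _} _ _.
Arguments id2 {_ _ _} _.
Arguments vcomp {_ _ _ _ _ _} _ _.
Arguments hcomp {_ _ _ _ _ _ _ _} _ _.
Arguments assoc {_ _ _ _ _} _ _ _.
Arguments assoc_inv {_ _ _ _ _} _ _ _.
Arguments lunit {_ _ _} _.
Arguments lunit_inv {_ _ _} _.
Arguments runit {_ _ _} _.
Arguments runit_inv {_ _ _} _.

Notation "g \o1 f" := (comp1 g f) (at level 40, left associativity) : bicat_scope.
Notation "b \o2 a" := (vcomp b a) (at level 50, left associativity) : bicat_scope.
Notation "b \*2 a" := (hcomp b a) (at level 40, left associativity) : bicat_scope.
Notation "f ==>2 g" := (cell2 f g) (at level 70, no associativity) : bicat_scope.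

Definition inverse2 (K : bicat_data) (A B : ob K) (f g : cell1 A B)
    (a : f ==>2 g) (b : g ==>2 f) : Prop :=
  b \o2 a = id2 f /\ a \o2 b = id2 g.

Definition invertible2 (K : bicat_data) (A B : ob K) (f g : cell1 A B)
    (a : f ==>2 g) : Prop :=
  exists b : g ==>2 f, inverse2 a b.

Record is_bicategory (K : bicat_data) : Prop := IsBicategory {
  vcompA : forall (A B : ob K) (f g h k : cell1 A B)
      (c : h ==>2 k) (b : g ==>2 h) (a : f ==>2 g),
    c \o2 (b \o2 a) = (c \o2 b) \o2 a;
  vcomp1l : forall (A B : ob K) (f g : cell1 A B) (a : f ==>2 g),
    id2 g \o2 a = a;
  vcomp1r : forall (A B : ob K) (f g : cell1 A B) (a : f ==>2 g),
    a \o2 id2 f = a;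

  hcomp_id : forall (A B C : ob K) (g : cell1 B C) (f : cell1 A B),
    id2 g \*2 id2 f = id2 (g \o1 f);
  hcomp_vcomp : forall (A B C : ob K)
      (g g' g'' : cell1 B C) (f f' f'' : cell1 A B)
      (b' : g' ==>2 g'') (b : g ==>2 g') (a' : f' ==>2 f'') (a : f ==>2 f'),
    (b' \o2 b) \*2 (a' \o2 a) = (b' \*2 a') \o2 (b \*2 a);

  assoc_inverse : forall (A B C D : ob K)
      (h : cell1 C D) (g : cell1 B C) (f : cell1 A B),
    inverse2 (assoc h g f) (assoc_inv h g f);
  lunit_inverse : forall (A B : ob K) (f : cell1 A B),
    inverse2 (lunit f) (lunit_inv f);
  runit_inverse : forall (A B : ob K) (f : cell1 A B),
    inverse2 (runit f) (runit_inv f);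

  assoc_natural : forall (A B C D : ob K)
      (h h' : cell1 C D) (g g' : cell1 B C) (f f' : cell1 A B)
      (c : h ==>2 h') (b : g ==>2 g') (a : f ==>2 f'),
    assoc h' g' f' \o2 ((c \*2 b) \*2 a) =
    (c \*2 (b \*2 a)) \o2 assoc h g f;
  lunit_natural : forall (A B : ob K) (f f' : cell1 A B) (a : f ==>2 f'),
    lunit f' \o2 (id2 (id1 B) \*2 a) = a \o2 lunit f;
  runit_natural : forall (A B : ob K) (f f' : cell1 A B) (a : f ==>2 f'),
    runit f' \o2 (a \*2 id2 (id1 A)) = a \o2 runit f;

  pentagon : forall (A B C D E : ob K)
      (k : cell1 D E) (h : cell1 C D) (g : cell1 B C) (f : cell1 A B),
    (id2 k \*2 assoc h g f) \o2 assoc k (h \o1 g) f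
      \o2 (assoc k h g \*2 id2 f) =
    assoc k h (g \o1 f) \o2 assoc (k \o1 h) g f;
  triangle : forall (A B C : ob K) (g : cell1 B C) (f : cell1 A B),
    (id2 g \*2 lunit f) \o2 assoc g (id1 B) f = runit g \*2 id2 f
}.

Record bicategory := Bicategory {
  bicat_data_of :> bicat_data;
  bicategoryP : is_bicategory bicat_data_of
}.

(* The 2-cells 1_r * s (for s : tr ==> 1) and s * 1_r (for s : rt ==> 1)
   from rtr to r, with the constraints written out; rtr is bracketed (rt)r.
   Taking r = p, t = q gives 1_p * mu and tau * 1_p; taking r = q, t = p
   gives 1_q * tau and mu * 1_q. *)
Definition whisker_counit_l (K : bicategory) (A B : ob K)
    (r : cell1 A B) (t : cell1 B A) (s : t \o1 r ==>2 id1 A) :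
    (r \o1 t) \o1 r ==>2 r :=
  runit r \o2 (id2 r \*2 s) \o2 assoc r t r.

Definition whisker_counit_r (K : bicategory) (A B : ob K)
    (r : cell1 A B) (t : cell1 B A) (s : r \o1 t ==>2 id1 B) :
    (r \o1 t) \o1 r ==>2 r :=
  lunit r \o2 (s \*2 id2 r).

Definition is_morita_context (K : bicategory) (A B : ob K)
    (p : cell1 A B) (q : cell1 B A)
    (mu : q \o1 p ==>2 id1 A) (tau : p \o1 q ==>2 id1 B) : Prop :=
  whisker_counit_l mu = whisker_counit_r tau /\
  whisker_counit_l tau = whisker_counit_r mu.

Definition is_firm_morita_context (K : bicategory) (A B : ob K)
    (p : cell1 A B) (q : cell1 B A)
    (mu : q \o1 p ==>2 id1 A) (tau : p \o1 q ==>2 id1 B) : Prop :=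
  is_morita_context mu tau /\
  invertible2 (whisker_counit_l mu) /\
  invertible2 (whisker_counit_l tau).

Definition morita_context_iso (K : bicategory) (A B : ob K)
    (p : cell1 A B) (q q' : cell1 B A)
    (mu : q \o1 p ==>2 id1 A) (tau : p \o1 q ==>2 id1 B)
    (mu' : q' \o1 p ==>2 id1 A) (tau' : p \o1 q' ==>2 id1 B)
    (phi : q ==>2 q') : Prop :=
  invertible2 phi /\
  mu' \o2 (phi \*2 id2 p) = mu /\
  tau' \o2 (id2 p \*2 phi) = tau.

(* Main.v *)
Require Import Defs.
From Stdlib Require Import ssreflect.

Set Implicit Arguments.
Unset Strict Implicit.
Unset Printing Implicit Defensive.

Local Open Scope bicat_scope.

(** A 2-cell [s : t r => 1] acts as a natural transformation
    [s_x : t (r x) => x] on the hom-categories [K(X, A)], where postcomposition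
    functors compose strictly; this absorbs the associativity constraints, and
    a Morita context gives [p mu_x = tau_(p x)] and [q tau_x = mu_(q x)].
    Firmness makes [q tau' tau : q p q' p q => q] invertible, and
    [phi := (mu q' tau) (q tau' tau)^-1] satisfies [tau' (p phi) = tau].
    Exchanging the contexts yields a candidate inverse, and an [f : q => q] with
    [tau (p f) = tau] is the identity because [mu q = q tau] is invertible.
    Finally [tau' (p phi) = tau] forces [mu' (phi p) = mu]: the two sides
    agree after whiskering with [q'] on the right, and hence after composing
    with the invertible [q p mu']. *)

Local Notation bicatP := (bicategoryP _).
Local Notation "g ◁ a" := (id2 g \*2 a) (at level 40, left associativity) : bicat_scope.
Local Notation "b ▷ f" := (b \*2 id2 f) (at level 40, left associativity) : bicat_scope.

(** * Vertical composition and whiskering *)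

(** Composites are kept bracketed to the left, where the last two factors do not form a subterm;
    this allows rewriting them. *)
Lemma vcomp_tail (K : bicategory) (A B : ob K) (f g h k : cell1 A B)
    (b : g ==>2 h) (a : f ==>2 g) (d : f ==>2 h) (c : h ==>2 k) :
  b \o2 a = d -> c \o2 b \o2 a = c \o2 d.
Proof. by move=> <-; rewrite (vcompA bicatP). Qed.

Lemma inverse2_sym (K : bicategory) (A B : ob K) (f g : cell1 A B)
    (a : f ==>2 g) (b : g ==>2 f) : inverse2 a b -> inverse2 b a.
Proof. by case. Qed.

Lemma inverse2_invertible (K : bicategory) (A B : ob K) (f g : cell1 A B)
    (a : f ==>2 g) (b : g ==>2 f) : inverse2 a b -> invertible2 a.
Proof. by exists b. Qed.

Lemma invertible2_comp (K : bicategory) (A B : ob K) (f g h : cell1 A B)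
    (b : g ==>2 h) (a : f ==>2 g) :
  invertible2 b -> invertible2 a -> invertible2 (b \o2 a).
Proof.
move=> [b' [b'b bb']] [a' [a'a aa']]; exists (a' \o2 b'); split.
- by rewrite (vcompA bicatP) (vcomp_tail _ b'b) (vcomp1r bicatP).
- by rewrite (vcompA bicatP) (vcomp_tail _ aa') (vcomp1r bicatP).
Qed.

Lemma invertible2_epi (K : bicategory) (A B : ob K) (f g h : cell1 A B)
    (a : f ==>2 g) (b c : g ==>2 h) :
  invertible2 a -> b \o2 a = c \o2 a -> b = c.
Proof.
move=> [a' [_ aa']] ba_ca.
by rewrite -(vcomp1r bicatP b) -(vcomp1r bicatP c) -aa' !(vcompA bicatP) ba_ca.
Qed.

Lemma invertible2_mono (K : bicategory) (A B : ob K) (f g h : cell1 A B)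
    (a : g ==>2 h) (b c : f ==>2 g) :
  invertible2 a -> a \o2 b = a \o2 c -> b = c.
Proof.
move=> [a' [a'a _]] ab_ac.
by rewrite -(vcomp1l bicatP b) -(vcomp1l bicatP c) -a'a -!(vcompA bicatP) ab_ac.
Qed.

Lemma whisker_l_vcomp (K : bicategory) (A B C : ob K) (g : cell1 B C)
    (f f' f'' : cell1 A B) (b : f' ==>2 f'') (a : f ==>2 f') :
  g ◁ (b \o2 a) = (g ◁ b) \o2 (g ◁ a).
Proof. by rewrite -(hcomp_vcomp bicatP) (vcomp1l bicatP). Qed.

Lemma whisker_r_vcomp (K : bicategory) (A B C : ob K) (f : cell1 A B)
    (g g' g'' : cell1 B C) (b : g' ==>2 g'') (a : g ==>2 g') :
  (b \o2 a) ▷ f = (b ▷ f) \o2 (a ▷ f).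
Proof. by rewrite -(hcomp_vcomp bicatP) (vcomp1l bicatP). Qed.

Lemma whisker_exchange (K : bicategory) (A B C : ob K) (g g' : cell1 B C)
    (f f' : cell1 A B) (b : g ==>2 g') (a : f ==>2 f') :
  (b ▷ f') \o2 (g ◁ a) = (g' ◁ a) \o2 (b ▷ f).
Proof. by rewrite -!(hcomp_vcomp bicatP) !(vcomp1l bicatP) !(vcomp1r bicatP). Qed.

Lemma whisker_l_inverse (K : bicategory) (A B C : ob K) (g : cell1 B C)
    (f f' : cell1 A B) (a : f ==>2 f') (b : f' ==>2 f) :
  inverse2 a b -> inverse2 (g ◁ a) (g ◁ b).
Proof. by move=> [ba ab]; split; rewrite -whisker_l_vcomp ?ba ?ab (hcomp_id bicatP). Qed.

Lemma whisker_r_inverse (K : bicategory) (A B C : ob K) (f : cell1 A B)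
    (g g' : cell1 B C) (a : g ==>2 g') (b : g' ==>2 g) :
  inverse2 a b -> inverse2 (a ▷ f) (b ▷ f).
Proof. by move=> [ba ab]; split; rewrite -whisker_r_vcomp ?ba ?ab (hcomp_id bicatP). Qed.

Lemma whisker_l_invertible (K : bicategory) (A B C : ob K) (g : cell1 B C)
    (f f' : cell1 A B) (a : f ==>2 f') : invertible2 a -> invertible2 (g ◁ a).
Proof. by move=> [b ab]; exists (g ◁ b); apply: whisker_l_inverse. Qed.

Lemma whisker_r_invertible (K : bicategory) (A B C : ob K) (f : cell1 A B)
    (g g' : cell1 B C) (a : g ==>2 g') : invertible2 a -> invertible2 (a ▷ f).
Proof. by move=> [b ab]; exists (b ▷ f); apply: whisker_r_inverse. Qed.

(** * Invertibility, naturality and coherence of the constraints *)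

Lemma assoc_invertible (K : bicategory) (A B C D : ob K)
    (h : cell1 C D) (g : cell1 B C) (f : cell1 A B) : invertible2 (assoc h g f).
Proof. exact: inverse2_invertible (assoc_inverse bicatP h g f). Qed.

Lemma assoc_inv_invertible (K : bicategory) (A B C D : ob K)
    (h : cell1 C D) (g : cell1 B C) (f : cell1 A B) :
  invertible2 (assoc_inv h g f).
Proof. exact: inverse2_invertible (inverse2_sym (assoc_inverse bicatP h g f)). Qed.

Lemma lunit_invertible (K : bicategory) (A B : ob K) (f : cell1 A B) :
  invertible2 (lunit f).
Proof. exact: inverse2_invertible (lunit_inverse bicatP f). Qed.

Lemma runit_invertible (K : bicategory) (A B : ob K) (f : cell1 A B) :
  invertible2 (runit f).
Proof. exact: inverse2_invertible (runit_inverse bicatP f). Qed.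

Lemma whisker_l_id_inj (K : bicategory) (A B : ob K) (f f' : cell1 A B)
    (a b : f ==>2 f') : id1 B ◁ a = id1 B ◁ b -> a = b.
Proof.
move=> ab; apply: (invertible2_epi (lunit_invertible f)).
by rewrite -!(lunit_natural bicatP) ab.
Qed.

Lemma whisker_r_id_inj (K : bicategory) (A B : ob K) (f f' : cell1 A B)
    (a b : f ==>2 f') : a ▷ id1 A = b ▷ id1 A -> a = b.
Proof.
move=> ab; apply: (invertible2_epi (runit_invertible f)).
by rewrite -!(runit_natural bicatP) ab.
Qed.

Lemma assoc_inv_natural (K : bicategory) (A B C D : ob K)
    (h h' : cell1 C D) (g g' : cell1 B C) (f f' : cell1 A B)
    (c : h ==>2 h') (b : g ==>2 g') (a : f ==>2 f') :
  assoc_inv h' g' f' \o2 (c \*2 (b \*2 a)) =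
  ((c \*2 b) \*2 a) \o2 assoc_inv h g f.
Proof.
apply: (invertible2_epi (assoc_invertible h g f)).
have [E _] := assoc_inverse bicatP h g f.
have [E' _] := assoc_inverse bicatP h' g' f'.
rewrite (vcomp_tail _ E) (vcomp1r bicatP).
by rewrite (vcomp_tail _ (eq_sym (assoc_natural bicatP _ _ _)))
  (vcompA bicatP) E' (vcomp1l bicatP).
Qed.

(* Kelly: this coherence law follows from the pentagon and the triangle. *)
Lemma lunit_comp (K : bicategory) (A B C : ob K) (g : cell1 B C) (f : cell1 A B) :
  lunit (g \o1 f) \o2 assoc (id1 C) g f = lunit g ▷ f.
Proof.
(* One more factor [id1 C], and two invertible associators, make this a face of the pentagon whose
   other faces are triangles and naturality squares. *)
apply: whisker_l_id_inj.
apply: (invertible2_epi (assoc_invertible (id1 C) (id1 C \o1 g) f)).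
apply: (invertible2_epi
  (whisker_r_invertible f (assoc_invertible (id1 C) (id1 C) g))).
rewrite -(assoc_natural bicatP) -[RHS](vcompA bicatP) -whisker_r_vcomp (triangle bicatP).
rewrite (assoc_natural bicatP) (hcomp_id bicatP) -(triangle bicatP).
rewrite whisker_l_vcomp -!(vcompA bicatP); congr (_ \o2 _).
by rewrite !(vcompA bicatP) (pentagon bicatP).
Qed.

Lemma lunit_comp_inv (K : bicategory) (A B C : ob K)
    (g : cell1 B C) (f : cell1 A B) :
  lunit (g \o1 f) = (lunit g ▷ f) \o2 assoc_inv (id1 C) g f.
Proof.
rewrite -lunit_comp -(vcompA bicatP).
by rewrite (proj2 (assoc_inverse bicatP _ _ _)) (vcomp1r bicatP).
Qed.

Lemma triangle_inv (K : bicategory) (A B C : ob K)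
    (g : cell1 B C) (f : cell1 A B) :
  g ◁ lunit f = (runit g ▷ f) \o2 assoc_inv g (id1 B) f.
Proof.
rewrite -(triangle bicatP) -(vcompA bicatP).
by rewrite (proj2 (assoc_inverse bicatP _ _ _)) (vcomp1r bicatP).
Qed.

Lemma pentagon_inv (K : bicategory) (A B C D E : ob K)
    (k : cell1 D E) (h : cell1 C D) (g : cell1 B C) (f : cell1 A B) :
  (assoc_inv k h g ▷ f) \o2 assoc_inv k (h \o1 g) f \o2 (k ◁ assoc_inv h g f) =
  assoc_inv (k \o1 h) g f \o2 assoc_inv k h (g \o1 f).
Proof.
have [I1 _] := assoc_inverse bicatP (k \o1 h) g f.
have [I2 _] := assoc_inverse bicatP k h (g \o1 f).
have [J1 _] := whisker_r_inverse f (assoc_inverse bicatP k h g).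
have [J2 _] := assoc_inverse bicatP k (h \o1 g) f.
have [J3 _] := whisker_l_inverse k (assoc_inverse bicatP h g f).
apply: (invertible2_epi (invertible2_comp
  (assoc_invertible k h (g \o1 f)) (assoc_invertible (k \o1 h) g f))).
rewrite [RHS](vcompA bicatP) (vcomp_tail _ I2) (vcomp1r bicatP) I1.
rewrite -(pentagon bicatP) !(vcompA bicatP).
by rewrite (vcomp_tail _ J3) (vcomp1r bicatP) (vcomp_tail _ J2) (vcomp1r bicatP).
Qed.

(** * The action of a counit on hom-categories *)

Definition counit_act (K : bicategory) (X A B : ob K)
    (r : cell1 A B) (t : cell1 B A) (s : t \o1 r ==>2 id1 A) (x : cell1 X A) :
    t \o1 (r \o1 x) ==>2 x :=
  lunit x \o2 (s ▷ x) \o2 assoc_inv t r x.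

Lemma counit_act_natural (K : bicategory) (X A B : ob K)
    (r : cell1 A B) (t : cell1 B A) (s : t \o1 r ==>2 id1 A)
    (x y : cell1 X A) (a : x ==>2 y) :
  counit_act s y \o2 (t ◁ (r ◁ a)) = a \o2 counit_act s x.
Proof.
rewrite /counit_act (vcomp_tail _ (assoc_inv_natural _ _ _)) !(vcompA bicatP).
congr (_ \o2 _).
rewrite (hcomp_id bicatP) (vcomp_tail _ (whisker_exchange _ _)) (vcompA bicatP).
by rewrite (lunit_natural bicatP).
Qed.

(** The associators on the right are those of [counit_act_comp], so an equality of whiskered counits
    passes to the actions by substitution. *)
Lemma whisker_l_counit_act (K : bicategory) (X A B : ob K)
    (r : cell1 A B) (t : cell1 B A) (s : t \o1 r ==>2 id1 A) (x : cell1 X A) :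
  r ◁ counit_act s x =
  (whisker_counit_l s ▷ x) \o2
    (assoc_inv (r \o1 t) r x \o2 assoc_inv r t (r \o1 x)).
Proof.
rewrite /counit_act /whisker_counit_l !whisker_l_vcomp triangle_inv.
rewrite (vcomp_tail _ (assoc_inv_natural _ _ _)) -pentagon_inv !whisker_r_vcomp.
rewrite !(vcompA bicatP); do 2 congr (_ \o2 _).
have [_ E] := whisker_r_inverse x (assoc_inverse bicatP r t r).
by rewrite (vcomp_tail _ E) (vcomp1r bicatP).
Qed.

Lemma counit_act_comp (K : bicategory) (X A B : ob K)
    (r : cell1 A B) (t : cell1 B A) (s : r \o1 t ==>2 id1 B) (x : cell1 X A) :
  counit_act s (r \o1 x) =
  (whisker_counit_r s ▷ x) \o2
    (assoc_inv (r \o1 t) r x \o2 assoc_inv r t (r \o1 x)).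
Proof.
rewrite /counit_act /whisker_counit_r lunit_comp_inv -(hcomp_id bicatP r x).
rewrite (vcomp_tail _ (assoc_inv_natural _ _ _)) whisker_r_vcomp.
by rewrite !(vcompA bicatP).
Qed.

Lemma counit_act_whisker (K : bicategory) (X A B : ob K)
    (r r' : cell1 A B) (t t' : cell1 B A) (s : t' \o1 r' ==>2 id1 A)
    (b : t ==>2 t') (a : r ==>2 r') (x : cell1 X A) :
  counit_act s x \o2 (b \*2 (a ▷ x)) = counit_act (s \o2 (b \*2 a)) x.
Proof.
rewrite /counit_act (vcomp_tail _ (assoc_inv_natural _ _ _)) whisker_r_vcomp.
by rewrite !(vcompA bicatP).
Qed.

(** At the identity 1-cell the action is the counit up to invertible constraints; this leads back
    from actions to 2-cells of the context. *)
Lemma counit_act_id_inj (K : bicategory) (A B : ob K)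
    (r : cell1 A B) (t : cell1 B A) (s s' : t \o1 r ==>2 id1 A) :
  counit_act s (id1 A) = counit_act s' (id1 A) -> s = s'.
Proof.
move=> ss'; apply/whisker_r_id_inj/(invertible2_mono (lunit_invertible _)).
exact: invertible2_epi (assoc_inv_invertible _ _ _) ss'.
Qed.

Lemma whisker_l_counit_act_invertible (K : bicategory) (X A B : ob K)
    (r : cell1 A B) (t : cell1 B A) (s : t \o1 r ==>2 id1 A) (x : cell1 X A) :
  invertible2 (whisker_counit_l s) -> invertible2 (r ◁ counit_act s x).
Proof.
move=> s_inv; rewrite whisker_l_counit_act.
apply/invertible2_comp/invertible2_comp; first exact: whisker_r_invertible.
- exact: assoc_inv_invertible.
- exact: assoc_inv_invertible.
Qed.

Lemma whisker_l_counit_act_swap (K : bicategory) (X A B : ob K)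
    (r : cell1 A B) (t : cell1 B A)
    (s : t \o1 r ==>2 id1 A) (u : r \o1 t ==>2 id1 B) (x : cell1 X A) :
  whisker_counit_l s = whisker_counit_r u ->
  r ◁ counit_act s x = counit_act u (r \o1 x).
Proof. by move=> su; rewrite whisker_l_counit_act counit_act_comp su. Qed.

(** * Comparison of firm Morita contexts *)

Lemma firm_comparison (K : bicategory) (X A B : ob K)
    (p : cell1 A B) (q q' : cell1 B A)
    (mu : q \o1 p ==>2 id1 A) (tau : p \o1 q ==>2 id1 B)
    (mu' : q' \o1 p ==>2 id1 A) (tau' : p \o1 q' ==>2 id1 B) (x : cell1 X B) :
  is_firm_morita_context mu tau -> is_firm_morita_context mu' tau' ->
  exists f : q \o1 x ==>2 q' \o1 x,
    counit_act tau' x \o2 (p ◁ f) = counit_act tau x.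
Proof.
move=> [[mt _] [_ ti]] [[mt' _] [mi' _]].
pose theta := counit_act tau' x \o2 (p ◁ (q' ◁ counit_act tau x)).
(* By naturality [theta] is tau_x after tau'_(p q x). Whiskered with [q], the first is invertible by
   firmness; the second is p mu'_(q x), invertible by firmness of the other context. *)
have [sigma [_ theta_sigma]] : invertible2 (q ◁ theta).
  rewrite /theta counit_act_natural whisker_l_vcomp.
  apply: invertible2_comp; first exact: whisker_l_counit_act_invertible.
  apply: whisker_l_invertible; rewrite -(whisker_l_counit_act_swap _ mt').
  exact: whisker_l_counit_act_invertible.
exists (counit_act mu (q' \o1 x) \o2 (q ◁ (p ◁ (q' ◁ counit_act tau x))) \o2 sigma).
(* Now p mu_(q' x) is tau_(p q' x); naturality of tau along tau'_x brings tau_x to the front,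
   followed by [p] applied to [q theta] after [sigma], an identity. *)
rewrite 2!whisker_l_vcomp (whisker_l_counit_act_swap _ mt).
(* A third [vcompA] would unfold [counit_act]. *)
rewrite 2!(vcompA bicatP) -counit_act_natural.
rewrite 2!(vcomp_tail _ (eq_sym (whisker_l_vcomp _ _ _))).
rewrite [X in p ◁ X](vcompA bicatP) -(whisker_l_vcomp q) theta_sigma.
by rewrite (hcomp_id bicatP) (vcomp1r bicatP).
Qed.

Lemma firm_endo_id (K : bicategory) (X A B : ob K)
    (p : cell1 A B) (q : cell1 B A)
    (mu : q \o1 p ==>2 id1 A) (tau : p \o1 q ==>2 id1 B) (x : cell1 X B)
    (f : q \o1 x ==>2 q \o1 x) :
  is_firm_morita_context mu tau ->
  counit_act tau x \o2 (p ◁ f) = counit_act tau x -> f = id2 (q \o1 x).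
Proof.
move=> [[_ tm] [_ ti]] tau_f.
have q_tau_inv := whisker_l_counit_act_invertible x ti.
have qpf : q ◁ (p ◁ f) = id2 _.
  apply: (invertible2_mono q_tau_inv).
  by rewrite -whisker_l_vcomp tau_f (vcomp1r bicatP).
(* Since q tau_x = mu_(q x), naturality of mu turns [qpf] into the claim about [f] itself. *)
apply: (invertible2_epi q_tau_inv).
rewrite (whisker_l_counit_act_swap _ tm) -counit_act_natural qpf.
by rewrite (vcomp1r bicatP) (vcomp1l bicatP).
Qed.

Lemma firm_compat_other_counit (K : bicategory) (A B : ob K)
    (p : cell1 A B) (q q' : cell1 B A)
    (mu : q \o1 p ==>2 id1 A) (tau : p \o1 q ==>2 id1 B)
    (mu' : q' \o1 p ==>2 id1 A) (tau' : p \o1 q' ==>2 id1 B)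
    (phi : q ==>2 q') :
  is_firm_morita_context mu tau -> is_firm_morita_context mu' tau' ->
  invertible2 phi -> tau' \o2 (p ◁ phi) = tau -> mu' \o2 (phi ▷ p) = mu.
Proof.
move=> [[_ tm] _] [[_ tm'] [mi' _]] phi_inv tau_phi.
have agree (X : ob K) (x : cell1 X B) :
    counit_act (mu' \o2 (phi ▷ p)) (q' \o1 x) = counit_act mu (q' \o1 x).
  (* Both sides become [phi ▷ x] after q tau_x: the right one by naturality of mu and mu q = q tau,
     the left one by mu' q' = q' tau', interchange and [tau_phi]. *)
  apply: (invertible2_epi
    (whisker_l_invertible q (whisker_l_invertible p
      (whisker_r_invertible x phi_inv)))).
  rewrite [RHS]counit_act_natural -(whisker_l_counit_act_swap _ tm).
  rewrite -counit_act_whisker (hcomp_id bicatP) -(whisker_l_counit_act_swap _ tm').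
  rewrite (vcomp_tail _ (whisker_exchange _ _)) (vcompA bicatP) -whisker_l_vcomp.
  by rewrite counit_act_whisker tau_phi whisker_exchange.
apply: counit_act_id_inj.
(* Naturality along mu' carries the equation from q' p 1 to 1, because q p mu' is invertible even
   where mu' is not. *)
apply: (invertible2_epi
  (whisker_l_invertible q (whisker_l_counit_act_invertible (id1 A) mi'))).
by rewrite !counit_act_natural agree.
Qed.

Unset Implicit Arguments.

Theorem theorem3p3p4 (K : bicategory) (A B : ob K)
    (p : cell1 A B) (q q' : cell1 B A)
    (mu : q \o1 p ==>2 id1 A) (tau : p \o1 q ==>2 id1 B)
    (mu' : q' \o1 p ==>2 id1 A) (tau' : p \o1 q' ==>2 id1 B)
    (Hfirm : is_firm_morita_context mu tau)
    (Hfirm' : is_firm_morita_context mu' tau') :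
  exists phi : q ==>2 q', morita_context_iso mu tau mu' tau' phi.
Proof.
have [f tau_f] := firm_comparison (id1 B) Hfirm Hfirm'.
have [g tau_g] := firm_comparison (id1 B) Hfirm' Hfirm.
have gf : g \o2 f = id2 _.
  by apply: (firm_endo_id Hfirm); rewrite whisker_l_vcomp (vcompA bicatP) tau_g.
have fg : f \o2 g = id2 _.
  by apply: (firm_endo_id Hfirm'); rewrite whisker_l_vcomp (vcompA bicatP) tau_f.
(* The comparison at [id1 B] relates q 1 to q' 1; conjugation by the right unitors gives a 2-cell
   from [q] to [q']. *)
pose phi := runit q' \o2 f \o2 runit_inv q.
have phi_inv : invertible2 phi.
  apply: invertible2_comp.
    by apply: invertible2_comp; [exact: runit_invertible | exists g].
  exact: inverse2_invertible (inverse2_sym (runit_inverse bicatP q)).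
have phi1 : phi ▷ id1 B = f.
  apply: (invertible2_mono (runit_invertible q')).
  rewrite (runit_natural bicatP) /phi (vcomp_tail _ (proj1 (runit_inverse bicatP q))).
  by rewrite (vcomp1r bicatP).
have tau_phi : tau' \o2 (p ◁ phi) = tau.
  by apply: counit_act_id_inj; rewrite -counit_act_whisker phi1.
exists phi; split=> //; split=> //.
exact: firm_compat_other_counit Hfirm Hfirm' phi_inv tau_phi.
Qed.
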